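(* Let $p$ be a prime number and let $n, k$ be integers with $n \ge 2$ and $1 \le k \le n/2$. Let $G = \mathbb{Z}/p^n$ be the cyclic group of order $p^n$ with generator $\sigma$, acting by ring automorphisms on a (not necessarily commutative) ring $R$ with unit element $1$, and let $U \subset G$ be the cyclic subgroup of order $p^{n-k}$ generated by $\sigma^{p^k}$. Let $x \in R$ satisfy $\mathrm{N}_U(x) = 1$. Define $z$ and $a \in R$ by $$z = p^{n-2k}\,\bigl(1 + \sigma + \sigma^2 + \cdots + \sigma^{p^k-1}\bigr)(x) - 1$$ and $$a = p^{n-2k}\, x + (1-\sigma)\biggl(\sum_{i=1}^{p^{n-k}-1}\bigl(1 + \sigma^{p^k} + \sigma^{2p^k} + \cdots + \sigma^{(i-1)p^k}\bigr)\bigl(x\,\sigma^{-ip^k}(z)\bigr)\biggr).$$ Then $\mathrm{N}_G(ax) = 1$.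
   Context: For a finite group $G$ acting on a ring $R$ by ring automorphisms and a subgroup $V$ of $G$, the norm map $\mathrm{N}_V : R \to R^V$ (where $R^V$ is the subring of $V$-invariant elements) is defined by $\mathrm{N}_V(r) = \sum_{g \in V} g(r)$. The action of $G$ on $R$ extends additively to an action of the integral group ring $\mathbb{Z}[G]$ on $R$; thus for instance $(1-\sigma)(r) = r - \sigma(r)$ and $(1+\sigma+\cdots+\sigma^m)(r) = r + \sigma(r) + \cdots + \sigma^m(r)$. Rings are associative with unit. *)

(* Defs.v *)
From mathcomp Require Import all_boot all_order all_fingroup all_algebra all_solvable.

Set Implicit Arguments.
Unset Strict Implicit.
Unset Printing Implicit Defensive.

Import GroupScope GRing.Theory.
Local Open Scope ring_scope.

(* [to r g] stands for g(r). MathComp actions are right actions,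
   [to r (g * h) = to (to r g) h]; for an abelian group these are the same as
   left actions. *)

(* Bijectivity of each [to^~ g] is part of [to] being an action. *)
Definition acts_by_ring_automorphisms (gT : finGroupType) (G : {group gT})
    (R : pzRingType) (to : action G R) : Prop :=
  forall g : gT, g \in G ->
    zmod_morphism (to^~ g) /\ monoid_morphism (to^~ g).

Definition norm_map (gT : finGroupType) (G : {group gT}) (R : pzRingType)
    (to : action G R) (V : {set gT}) (r : R) : R :=
  \sum_(g in V) to r g.

(* Main.v *)
From HB Require Import structures.
Require Import Defs.
From mathcomp Require Import all_boot all_order all_fingroup all_algebra all_solvable.

Set Implicit Arguments.
Unset Strict Implicit.
Unset Printing Implicit Defensive.

Import GroupScope GRing.Theory.
Local Open Scope ring_scope.

(** Write S for the action of sigma, q = p ^ k, m = p ^ (n - k), T = S ^ q (so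
    that N_U = 1 + T + ... + T ^ (m - 1)) and c = p ^ (n - 2k), so that
    c * q = m.  The proof rests on the identity

      a + S a + ... + S ^ (q - 1) a = 1.                                  (1)

    Applying S to (1) and subtracting gives S ^ q a = a, so a is U-invariant.
    Since N_G is the sum of the S ^ j N_U for j < q, and since N_U x = 1,
    N_G (a x) is the sum of the S ^ j (a N_U x) = S ^ j a, which is 1 by (1):
    this is [orbit_sum_mul_eq1] (with [orbit_sumM] splitting the sum over G).

    To see (1), let y = x + S x + ... + S ^ (q - 1) x, so that z = c y - 1.
    The term c x of a contributes c y = z + 1 to the left-hand side, and the
    term s - S s contributes s - T s by telescoping; so (1) amounts to
    T s - s = z.  Now N_U z = c (1 + S + ... + S ^ (q - 1)) (N_U x) - m = 0,
    and s is the explicit solution of T s - s = z given by additive Hilbert 90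
    for U, in which x serves as an element of trace 1: this is [hilbert90]. *)

Section OrbitSum.

Variable R : pzRingType.
Implicit Types (f : {rmorphism R -> R}) (r : R).

Definition orbit_sum (f : R -> R) n r : R := \sum_(0 <= i < n) iter i f r.

(** The powers of f are declared as ring morphisms so that the results below apply
    to f ^ q, the generator of the subgroup of index q. *)
Lemma iter_zmod_morphism f n : zmod_morphism (iter n f).
Proof. by elim: n => // n IHn x y; rewrite /= IHn rmorphB. Qed.

Lemma iter_monoid_morphism f n : monoid_morphism (iter n f).
Proof.
by elim: n => // n [IH1 IHM]; split=> [|x y]; rewrite /= ?IH1 ?IHM ?rmorph1 ?rmorphM.
Qed.

HB.instance Definition _ f n :=
  GRing.isZmodMorphism.Build R R (iter n f) (iter_zmod_morphism f n).
HB.instance Definition _ f n :=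
  GRing.isMonoidMorphism.Build R R (iter n f) (iter_monoid_morphism f n).

Lemma orbit_sum_zmod_morphism f n : zmod_morphism (orbit_sum f n).
Proof.
by move=> x y; rewrite /orbit_sum -sumrB; apply: eq_bigr => i _; rewrite rmorphB.
Qed.

HB.instance Definition _ f n :=
  GRing.isZmodMorphism.Build R R (orbit_sum f n) (orbit_sum_zmod_morphism f n).

Lemma orbit_sum1 f n : orbit_sum f n 1 = n%:R.
Proof.
rewrite /orbit_sum (eq_bigr (fun=> 1)) => [|i _]; last exact: rmorph1.
by rewrite sumr_const_nat subn0.
Qed.

Lemma orbit_sum_morph f n r : orbit_sum f n (f r) = f (orbit_sum f n r).
Proof. by rewrite rmorph_sum; apply: eq_bigr => i _; rewrite -iterSr. Qed.

Lemma orbit_sum_telescope f n r : orbit_sum f n (f r - r) = iter n f r - r.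
Proof.
rewrite -(telescope_sumr (fun i => iter i f r) (leq0n n)).
by apply: eq_bigr => i _; rewrite rmorphB /= -iterSr.
Qed.

(** The orbit sums of f and f ^ q commute since all powers of f do: both sides
    are the sum of the f ^ (i q + j) r for i < m and j < q. *)
Lemma orbit_sumC f q m r :
  orbit_sum (iter q f) m (orbit_sum f q r)
    = orbit_sum f q (orbit_sum (iter q f) m r).
Proof.
transitivity (\sum_(0 <= i < m) \sum_(0 <= j < q) iter (i * q + j) f r).
  apply: eq_bigr => i _; rewrite raddf_sum; apply: eq_bigr => j _.
  by rewrite iterD iterM.
rewrite exchange_big; apply: eq_bigr => j _; rewrite raddf_sum.
by apply: eq_bigr => i _; rewrite addnC iterD iterM.
Qed.

(** When f has order q * m, this is the transitivity of the trace through the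
    subgroup generated by f ^ q. *)
Lemma orbit_sumM f q m r :
  orbit_sum f (q * m) r = orbit_sum f q (orbit_sum (iter q f) m r).
Proof.
rewrite -orbit_sumC /orbit_sum mulnC big_nat_mul; apply: eq_bigr => i _.
rewrite raddf_sum mulSn -{1}[(i * q)%N]add0n big_addn addnK.
by apply: eq_bigr => j _; rewrite addnC iterD iterM.
Qed.

(** Additive Hilbert 90 for a cyclic group of order m generated by f, in the
    presence of an element x of trace 1.  For each i the inner sum is the partial
    trace 1 + f + ... + f ^ (i - 1) of w = x * f ^ (- i) z, so f s - s is the sum
    of the f ^ i w - w = f ^ i x * z - x * f ^ (- i) z. *)
Lemma hilbert90 f m x z : (0 < m)%N -> iter m f =1 id ->
    orbit_sum f m x = 1 -> orbit_sum f m z = 0 ->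
  let s := \sum_(1 <= i < m) \sum_(0 <= j < i) iter j f (x * iter (m - i) f z)
  in f s - s = z.
Proof.
move=> m_gt0 f_m trx trz /=.
rewrite rmorph_sum -sumrB.
rewrite (eq_big_nat _ _ (F2 := fun i => iter i f x * z - x * iter (m - i) f z));
  last first.
  move=> i /andP[_ lt_im].
  rewrite -/(orbit_sum f i _) -orbit_sum_morph -raddfB /= orbit_sum_telescope.
  rewrite rmorphM /=.
  by rewrite -iterD subnKC ?f_m // ltnW.
(* The i = 0 term vanishes, so that both sums run over the whole group. *)
have -> (F : nat -> R) : F 0%N = 0 -> \sum_(1 <= i < m) F i = \sum_(0 <= i < m) F i.
  by move=> F0; rewrite [RHS]big_ltn // F0 add0r.
  rewrite sumrB -mulr_suml -mulr_sumr -/(orbit_sum f m x) trx mul1r.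
  rewrite big_nat_rev /= add0n.
  rewrite (eq_big_nat _ _ (F2 := fun i => f (iter i f z))); last first.
    by move=> i /andP[_ lt_im]; rewrite subKn.
  by rewrite -rmorph_sum -/(orbit_sum f m z) trz rmorph0 mulr0 subr0.
by rewrite subn0 f_m subrr.
Qed.

(** Applying f to an f-orbit sum of length q only exchanges its end terms a and
    f ^ q a, and f fixes 1. *)
Lemma orbit_sum_eq1_fixed f q a : orbit_sum f q a = 1 -> iter q f a = a.
Proof.
move=> tra; apply/eqP; rewrite -subr_eq0 -orbit_sum_telescope raddfB /=.
by rewrite orbit_sum_morph tra rmorph1 subrr.
Qed.

(** By [orbit_sum_eq1_fixed], f ^ q fixes a, which therefore comes out of the
    inner trace (over the subgroup) of a * x, leaving the outer one of a. *)
Lemma orbit_sum_mul_eq1 f q m a x :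
    orbit_sum f q a = 1 -> orbit_sum (iter q f) m x = 1 ->
  orbit_sum f (q * m) (a * x) = 1.
Proof.
move=> tra trx; rewrite orbit_sumM.
suff ->: orbit_sum (iter q f) m (a * x) = a * orbit_sum (iter q f) m x.
  by rewrite trx mulr1.
rewrite [in RHS]/orbit_sum mulr_sumr; apply: eq_bigr => i _.
by rewrite rmorphM /= (iter_fix _ (orbit_sum_eq1_fixed tra)).
Qed.

End OrbitSum.

Lemma sum_cycle (gT : finGroupType) (y : gT) (R : pzRingType) (F : gT -> R) :
  \sum_(g in <[y]>%g) F g = \sum_(0 <= i < #[y]%g) F (y ^+ i)%g.
Proof.
have tE : traject ( *%g y) 1%g #[y]%g = [seq (y ^+ i)%g | i <- iota 0 #[y]%g].
  apply: (@eq_from_nth _ 1%g) => [|i]; rewrite size_traject ?size_map ?size_iota //.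
  move=> lt_i; rewrite nth_traject // (nth_map 0%N) ?size_iota // nth_iota //.
  exact: iter_mulg_1.
rewrite (eq_bigl _ _ (cycle_traject y)) -big_uniq; last first.
  by apply/card_uniqP; rewrite size_traject -(eq_card (cycle_traject y)).
by rewrite tE big_map /index_iota subn0.
Qed.

(** Stated, like [actionX], for an arbitrary type X: the carrier of R may be
    infinite. *)
Lemma action1 (gT : finGroupType) (G : {group gT}) (X : Type)
  (to : action G X) r : to r 1%g = r.
Proof.
by case: to => act [injact actM] /=; apply: (injact 1%g); rewrite -actM ?mulg1.
Qed.

Lemma actionX (gT : finGroupType) (G : {group gT}) (X : Type)
  (to : action G X) g i r : g \in G -> to r (g ^+ i)%g = iter i (to^~ g) r.
Proof.
move=> Gg; elim: i => [|i /= <-]; first exact: action1.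
by case: to => act [_ actM] /=; rewrite expgSr actM ?groupX.
Qed.

Theorem mainTheorem1 (p n k : nat) (p_pr : prime p) (n_ge2 : (2 <= n)%N)
    (k_ge1 : (1 <= k)%N) (k_le : (2 * k <= n)%N)
    (gT : finGroupType) (G : {group gT}) (sigma : gT)
    (sigma_gen : generator G sigma) (oG : #|G| = (p ^ n)%N)
    (R : pzRingType) (to : action G R)
    (to_ring : acts_by_ring_automorphisms to)
    (x : R) (Nx : norm_map to <[(sigma ^+ (p ^ k))%g]> x = 1)
    (z : R)
    (z_def : z = (p ^ (n - 2 * k))%:R
                   * (\sum_(0 <= j < p ^ k) to x (sigma ^+ j)%g) - 1)
    (s : R)
    (s_def : s = \sum_(1 <= i < p ^ (n - k)) \sum_(0 <= j < i)
                   to (x * to z (sigma ^- (i * p ^ k))%g) (sigma ^+ (j * p ^ k))%g)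
    (a : R)
    (a_def : a = (p ^ (n - 2 * k))%:R * x + (s - to s sigma)) :
  norm_map to G (a * x) = 1.
Proof.
have defG : G :=: <[sigma]>%g by apply/eqP.
have Gsigma : sigma \in G by rewrite defG cycle_id.
set q := (p ^ k)%N in Nx z_def s_def a_def *.
set m := (p ^ (n - k))%N in s_def.
set c := (p ^ (n - 2 * k))%N in z_def a_def.
have p_gt0 := prime_gt0 p_pr.
have q_gt0 : (0 < q)%N by rewrite expn_gt0 p_gt0.
have m_gt0 : (0 < m)%N by rewrite expn_gt0 p_gt0.
have le_kn : (k <= n)%N by apply: leq_trans k_le; rewrite mul2n -addnn leq_addr.
have cqE : (c * q = m)%N.
  rewrite -expnD mul2n -addnn subnDA subnK //.
  by rewrite leq_subRL // addnn -mul2n.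
have qmE : (q * m = p ^ n)%N by rewrite -expnD subnKC.
have o_sigma : #[sigma]%g = (q * m)%N by rewrite qmE -oG defG.
have o_tau : #[(sigma ^+ q)%g]%g = m.
  by rewrite orderXdiv o_sigma ?dvdn_mulr // mulKn.
have [toB toM] := to_ring _ Gsigma.
(* S is kept abstract: unfolding it would hide the morphism structure that the
   additivity lemmas look for on the powers and orbit sums of S. *)
have [S SE] : exists S : {rmorphism R -> R}, S =1 to^~ sigma.
  pose SZ := GRing.isZmodMorphism.Build R R (to^~ sigma) toB.
  pose SM := GRing.isMonoidMorphism.Build R R (to^~ sigma) toM.
  by exists (HB.pack (to^~ sigma) SZ SM : {rmorphism R -> R}).
have toX i r : to r (sigma ^+ i)%g = iter i S r.
  by rewrite actionX // (eq_iter SE).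
have toXq i r : to r (sigma ^+ (i * q))%g = iter i (iter q S) r.
  by rewrite toX iterM.
have T_m r : iter m (iter q S) r = r.
  by rewrite -toXq mulnC -o_sigma expg_order action1.
have NG r : norm_map to G r = orbit_sum S (q * m) r.
  rewrite /norm_map (eq_bigl (fun g => g \in <[sigma]>%g)) => [|g].
    by rewrite sum_cycle o_sigma; apply: eq_bigr => i _; rewrite toX.
  by rewrite -defG.
have {}Nx : orbit_sum (iter q S) m x = 1.
  rewrite -Nx /norm_map sum_cycle o_tau; apply: eq_bigr => i _.
  by rewrite -expgM mulnC toXq.
have {}z_def : z = c%:R * orbit_sum S q x - 1.
  by rewrite z_def; congr (_ * _ - 1); apply: eq_bigr => j _; rewrite toX.
have Nz : orbit_sum (iter q S) m z = 0.
  rewrite z_def raddfB /= mulr_natl raddfMn /= orbit_sumC Nx !orbit_sum1.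
  by rewrite -mulrnA mulnC cqE subrr.
(* T has order m, so T ^ (- i) is the nonnegative power T ^ (m - i). *)
have {}s_def : s = \sum_(1 <= i < m) \sum_(0 <= j < i)
    iter j (iter q S) (x * iter (m - i) (iter q S) z).
  rewrite s_def; apply: eq_big_nat => i /andP[_ lt_im]; apply: eq_bigr => j _.
  rewrite toXq -[in RHS](toXq (m - i)%N); congr (iter j _ (x * to z _)).
  apply/eqP; rewrite eq_invg_mul -expgD -mulnDl subnKC 1?ltnW //.
  by rewrite mulnC -o_sigma expg_order.
have Ts : iter q S s - s = z.
  by rewrite s_def; apply: (hilbert90 (f := iter q S)).
rewrite NG; apply: orbit_sum_mul_eq1 => //.
have -> : a = c%:R * x - (S s - s) by rewrite a_def opprB SE.
rewrite raddfB /= orbit_sum_telescope Ts mulr_natl raddfMn /= -mulr_natl.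
by rewrite z_def opprB addrC subrK.
Qed.
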